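(* Let $(\ast,\boldsymbol{E},g^\lambda)$ be a localized formal Frobenius structure over $K[\lambda]$ of charge $D$ on $M^\dagger$. Let $\circ$ be the multiplication on $\mathcal{T}_{M^\dagger}$ induced from $\ast$ by the projection $\pi:\mathcal{T}^\lambda_{M^\dagger}\to\mathcal{T}_{M^\dagger}=\mathcal{T}^\lambda_{M^\dagger}/\lambda\mathcal{T}^\lambda_{M^\dagger}$, let $E=\pi(\boldsymbol{E})$, and let $(I_\bullet,g_\bullet)$ be the nondegenerate filtration on $H_K$ induced from the localized $K[\lambda]$-metric $g^\lambda$. Then $(\circ,E,I_\bullet,g_\bullet)$ is a formal mixed Frobenius structure on $M^\dagger$ of charges $\{D_k=D-k\}$.
   Context: Setting. $K$ is a subfield of $\mathbb{C}$; $n\ge1$, $m\ge0$ are integers; $R=K[[t_1,\dots,t_n,q_1,\dots,q_m]]$; $M=\mathrm{Spf}\,R$; $M^\dagger$ is $M$ with the logarithmic structure associated to the monoid $P=\{\Phi\in R\mid \exists d_1,\dots,d_m\in\mathbb{Z}_{\ge0}: q_1^{-d_1}\cdots q_m^{-d_m}\Phi\in R^\times\}$. Put $$H_K=\bigoplus_{\alpha=1}^n K\tfrac{\partial}{\partial t_\alpha}\oplus\bigoplus_{i=1}^m K q_i\tfrac{\partial}{\partial q_i}.$$ The sheaf of logarithmic vector fields is $\mathcal{T}_{M^\dagger}=\mathcal{O}_M\otimes_K H_K$ (free over $\mathcal{O}_M$, i.e. over $R$), with flat connection $\nabla=d\otimes 1_{H_K}$ and Lie bracket $[x,y]=\nabla_xy-\nabla_yx$.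 Put $\mathcal{O}_M^\lambda=\mathcal{O}_M\otimes_KK[\lambda]$, $H_K^\lambda=H_K\otimes_KK[\lambda]$, $\mathcal{T}^\lambda_{M^\dagger}=\mathcal{T}_{M^\dagger}\otimes_KK[\lambda]=\mathcal{O}_M\otimes_KH_K^\lambda$; $\nabla$ and $[\,,]$ are extended $K[\lambda]$-linearly. All multiplications below are associative and commutative and have a unit. Nondegenerate filtration. A metric is a nondegenerate symmetric bilinear form. A nondegenerate filtration on a finite-dimensional vector space $V$ is an exhaustive increasing filtration $(I_k)_{k\in\mathbb{Z}}$ by subspaces ($I_k=V$ for $k\gg0$, $I_k=0$ for $k\ll0$) with a metric $g_k$ on each $I_k/I_{k-1}$. Localized metric. A localized $K[\lambda]$-metric on $H_K^\lambda$ is a symmetric $K[\lambda]$-bilinear form $g^\lambda:H_K^\lambda\times H_K^\lambda\to K[\lambda,\lambda^{-1}]$ whose Gram matrix in a $K[\lambda]$-basis is invertible over $K[\lambda,\lambda^{-1}]$. It induces a nondegenerate filtration on $H_K=H_K^\lambda/\lambda H_K^\lambda$: with $I_k^\lambda=\{\boldsymbol{x}\in H^\lambda_K\mid\lambda^kg^\lambda(\boldsymbol{x},\boldsymbol{y})\in K[\lambda]\ \forall\boldsymbol{y}\in H_K^\lambda\}$, $I_k$ is the image of $I_k^\lambda$ in $H_K$, and $g_k(\bar x,\bar y)=\mathrm{Res}_{\lambda=0}\lambda^{k-1}g^\lambda(\boldsymbol{x},\boldsymbol{y})$ for any lifts $\boldsymbol{x},\boldsymbol{y}\in I_k^\lambda$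 of $x,y\in I_k$ (independent of choices), where $\bar x$ is the class modulo $I_{k-1}$. Localized formal Frobenius structure over $K[\lambda]$ of charge $D\in K$ on $M^\dagger$: an $\mathcal{O}_M^\lambda$-bilinear multiplication $\ast$ on $\mathcal{T}^\lambda_{M^\dagger}$, an element $\boldsymbol{E}\in\mathcal{T}^\lambda_{M^\dagger}$ and a localized $K[\lambda]$-metric $g^\lambda$ on $H_K^\lambda$ such that (i) $\nabla_{\boldsymbol{x}}(\boldsymbol{y}\ast\boldsymbol{z})=\nabla_{\boldsymbol{y}}(\boldsymbol{x}\ast\boldsymbol{z})$ for $\boldsymbol{x},\boldsymbol{y},\boldsymbol{z}\in H_K^\lambda$, and the unit $\boldsymbol{e}$ satisfies $\nabla\boldsymbol{e}=0$, i.e. $\boldsymbol{e}\in H_K^\lambda$; (ii) $\nabla_{\boldsymbol{x}}\nabla_{\boldsymbol{y}}\boldsymbol{E}=0$ for $\boldsymbol{x},\boldsymbol{y}\in H_K^\lambda$, and with $\boldsymbol{E}^\lambda=\boldsymbol{E}+\lambda\frac{\partial}{\partial\lambda}$ (acting as a derivation; $\lambda\frac{\partial}{\partial\lambda}$ kills $H_K$, $t$, $q$, and $[\boldsymbol{E}^\lambda,\boldsymbol{x}]=[\boldsymbol{E},\boldsymbol{x}]+\lambda\frac{\partial}{\partial\lambda}\boldsymbol{x}$), $[\boldsymbol{E}^\lambda,\boldsymbol{x}\ast\boldsymbol{y}]-\boldsymbol{x}\ast[\boldsymbol{E}^\lambda,\boldsymbol{y}]-[\boldsymbol{E}^\lambda,\boldsymbol{x}]\ast\boldsymbol{y}=\boldsymbol{x}\ast\boldsymbol{y}$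 for $\boldsymbol{x},\boldsymbol{y}\in\mathcal{T}^\lambda_{M^\dagger}$; (iii) $g^\lambda$, extended $\mathcal{O}_M^\lambda$-bilinearly to $\mathcal{T}^\lambda_{M^\dagger}$, is $\ast$-invariant: $g^\lambda(\boldsymbol{x}\ast\boldsymbol{y},\boldsymbol{z})=g^\lambda(\boldsymbol{x},\boldsymbol{y}\ast\boldsymbol{z})$; (iv) $\boldsymbol{E}^\lambda g^\lambda(\boldsymbol{x},\boldsymbol{y})-g^\lambda([\boldsymbol{E}^\lambda,\boldsymbol{x}],\boldsymbol{y})-g^\lambda(\boldsymbol{x},[\boldsymbol{E}^\lambda,\boldsymbol{y}])=(2-D)g^\lambda(\boldsymbol{x},\boldsymbol{y})$ for $\boldsymbol{x},\boldsymbol{y}\in\mathcal{T}^\lambda_{M^\dagger}$. Formal Saito structure on $M^\dagger$: an $\mathcal{O}_M$-bilinear multiplication $\circ$ on $\mathcal{T}_{M^\dagger}$ and $E\in\mathcal{T}_{M^\dagger}$ such that (i) $\nabla_x(y\circ z)=\nabla_y(x\circ z)$ for $x,y,z\in H_K$ and the unit $e$ satisfies $\nabla e=0$; (ii) $\nabla_x\nabla_yE=0$ for $x,y\in H_K$ and $[E,x\circ y]-x\circ[E,y]-[E,x]\circ y=x\circ y$ for $x,y\in\mathcal{T}_{M^\dagger}$. Formal mixed Frobenius structure on $M^\dagger$ with charges $\{D_k\in K\mid k\in\mathbb{Z},\ I_k/I_{k-1}\ne0\}$: a formal Saito structure $(\circ,E)$ together with a nondegenerate filtration $(I_\bullet,g_\bullet)$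 on $H_K$ such that, with $\mathcal{I}_k=\mathcal{O}_M\otimes_KI_k$ and $g_k$ extended $\mathcal{O}_M$-bilinearly (to $\mathcal{I}_k/\mathcal{I}_{k-1}$, hence to $\mathcal{I}_k$ through the projection $x\mapsto\bar x$): (i) $\mathcal{I}_k$ is an ideal for $\circ$ and $g_k(x\circ y,z)=g_k(y,x\circ z)$ for $x\in\mathcal{T}_{M^\dagger}$, $y,z\in\mathcal{I}_k$; (ii) $[E,x]\in\mathcal{I}_k$ for $x\in\mathcal{I}_k$, and $Eg_k(\bar x,\bar y)-g_k(\overline{[E,x]},\bar y)-g_k(\bar x,\overline{[E,y]})=(2-D_k)g_k(\bar x,\bar y)$ for $x,y\in\mathcal{I}_k$. *)

(* Defs.v *)
From HB Require Import structures.
From mathcomp Require Import all_boot all_order all_algebra.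
From mathcomp Require Import sesquilinear.
From mathcomp Require Import boolp.
From mathcomp Require Import mpoly.
From mathcomp Require Import ring zify.

Set Implicit Arguments.
Unset Strict Implicit.
Unset Printing Implicit Defensive.

Import GRing.Theory.
Local Open Scope ring_scope.
Local Open Scope quotient_scope.

(* A series is the family of its coefficients. *)
Definition mfps (N : nat) (K : comNzRingType) : Type := 'X_{1..N} -> K.

Section PowerSeries.
Variables (N : nat) (K : comNzRingType).
Implicit Types (f g h : mfps N K) (a b : 'X_{1..N}) (P Q : {mpoly K[N]}).

HB.instance Definition _ := gen_eqMixin (mfps N K).
HB.instance Definition _ := gen_choiceMixin (mfps N K).

Definition mfps_add f g : mfps N K := fun a => f a + g a.
Definition mfps_opp f : mfps N K := fun a => - f a.
Definition mfps_zero : mfps N K := fun=> 0.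

Fact mfps_addA : associative mfps_add.
Proof. by move=> f g h; apply: funext => a; rewrite /mfps_add addrA. Qed.
Fact mfps_addC : commutative mfps_add.
Proof. by move=> f g; apply: funext => a; rewrite /mfps_add addrC. Qed.
Fact mfps_add0 : left_id mfps_zero mfps_add.
Proof. by move=> f; apply: funext => a; rewrite /mfps_add add0r. Qed.
Fact mfps_addN : left_inverse mfps_zero mfps_opp mfps_add.
Proof. by move=> f; apply: funext => a; rewrite /mfps_add addNr. Qed.

HB.instance Definition _ :=
  GRing.isZmodule.Build (mfps N K) mfps_addA mfps_addC mfps_add0 mfps_addN.

Definition mfpsC (c : K) : mfps N K := fun a => if a == 0%MM then c else 0.

(* Every pair (b, c) with b + c = a has both degrees at most [mdeg a]. *)
Definition mfps_mul f g : mfps N K := fun a =>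
  \sum_(k : 'X_{1..N < (mdeg a).+1, (mdeg a).+1} | a == (k.1 + k.2)%MM)
     f k.1 * g k.2.

Definition mfps_trunc d f : {mpoly K[N]} :=
  \sum_(b : 'X_{1..N < d}) f b *: 'X_[b].

Definition mfps_agree d f P := forall a, (mdeg a < d)%N -> f a = P@_a.

Fact mfps_truncP d f : mfps_agree d f (mfps_trunc d f).
Proof.
move=> a ad; rewrite /mfps_trunc raddf_sum /=.
rewrite (bigD1 (BMultinom ad)) //= mcoeffZ mcoeffX eqxx mulr1.
rewrite big1 ?addr0 // => b neq_ba.
rewrite mcoeffZ mcoeffX; case: eqP => [eq_ba|_]; last by rewrite mulr0.
by case/eqP: neq_ba; apply: val_inj.
Qed.

Fact mfps_agreeM d f g P Q : mfps_agree d f P -> mfps_agree d g Q ->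
  mfps_agree d (mfps_mul f g) (P * Q).
Proof.
move=> fP gQ a ad; rewrite /mfps_mul mcoeffM; apply: eq_bigr.
move=> -[[b _] [c _]] /= /eqP abc; rewrite abc mdegD in ad.
rewrite fP ?gQ //; apply: leq_ltn_trans ad; rewrite ?leq_addl //.
exact: leq_addr.
Qed.

Fact mfps_agree_eq f g :
  (forall d, exists2 P, mfps_agree d f P & mfps_agree d g P) -> f = g.
Proof.
move=> fg; apply: funext => a; have [P fP gP] := fg (mdeg a).+1.
by rewrite fP ?gP.
Qed.

Fact mfps_agree1 d : mfps_agree d (mfpsC 1) 1.
Proof. by move=> a _; rewrite mcoeff1 /mfpsC; case: eqP. Qed.

Fact mfps_agreeD d f g P Q : mfps_agree d f P -> mfps_agree d g Q ->
  mfps_agree d (f + g) (P + Q).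
Proof. by move=> fP gQ a ad; rewrite mcoeffD -fP -?gQ. Qed.

Fact mfps_mulA : associative mfps_mul.
Proof.
move=> f g h; apply: mfps_agree_eq => d.
exists (mfps_trunc d f * (mfps_trunc d g * mfps_trunc d h)); last rewrite mulrA;
  do ![exact: mfps_truncP | apply: mfps_agreeM].
Qed.
Fact mfps_mulC : commutative mfps_mul.
Proof.
move=> f g; apply: mfps_agree_eq => d.
exists (mfps_trunc d f * mfps_trunc d g); last rewrite mulrC;
  do ![exact: mfps_truncP | apply: mfps_agreeM].
Qed.
Fact mfps_mul1 : left_id (mfpsC 1) mfps_mul.
Proof.
move=> f; apply: mfps_agree_eq => d; exists (1 * mfps_trunc d f).
  by apply: mfps_agreeM; [exact: mfps_agree1 | exact: mfps_truncP].
by rewrite mul1r; exact: mfps_truncP.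
Qed.
Fact mfps_mulDl : left_distributive mfps_mul +%R.
Proof.
move=> f g h; apply: mfps_agree_eq => d.
exists ((mfps_trunc d f + mfps_trunc d g) * mfps_trunc d h);
  last rewrite mulrDl;
  do ![exact: mfps_truncP | apply: mfps_agreeM | apply: mfps_agreeD].
Qed.
Fact mfps_nonzero1 : mfpsC 1 != 0 :> mfps N K.
Proof.
apply/eqP => /(congr1 (fun f : mfps N K => f 0%MM)).
by rewrite /mfpsC eqxx; apply/eqP; exact: oner_neq0.
Qed.

HB.instance Definition _ := GRing.Zmodule_isComNzRing.Build (mfps N K)
  mfps_mulA mfps_mulC mfps_mul1 mfps_mulDl mfps_nonzero1.

Fact mfpsC_is_zmod_morphism : zmod_morphism mfpsC.
Proof.
move=> c d; apply: funext => a.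
change (mfpsC (c - d) a = mfpsC c a - mfpsC d a).
by rewrite /mfpsC; case: eqP; rewrite ?subr0.
Qed.
HB.instance Definition _ :=
  GRing.isZmodMorphism.Build K (mfps N K) mfpsC mfpsC_is_zmod_morphism.

Fact mfpsC_is_monoid_morphism : monoid_morphism mfpsC.
Proof.
split=> // c d; apply: mfps_agree_eq => n.
have agC (u : K) : mfps_agree n (mfpsC u) u%:MP.
  by move=> a _; rewrite mcoeffC /mfpsC; case: eqP; rewrite ?(mulr1, mulr0).
exists ((c * d)%:MP); first exact: agC.
by rewrite mpolyCM; apply: mfps_agreeM; exact: agC.
Qed.
HB.instance Definition _ :=
  GRing.isMonoidMorphism.Build K (mfps N K) mfpsC mfpsC_is_monoid_morphism.

(* d/dx_i *)
Definition mfps_partial (i : 'I_N) f : mfps N K :=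
  fun a => (a i).+1%:R * f (a + U_(i))%MM.

(* x_i d/dx_i *)
Definition mfps_euler (i : 'I_N) f : mfps N K := fun a => (a i)%:R * f a.

Fact mfps_partial_is_zmod_morphism i : zmod_morphism (mfps_partial i).
Proof. by move=> f g; apply: funext => a; rewrite [LHS]mulrBr. Qed.
HB.instance Definition _ i := GRing.isZmodMorphism.Build (mfps N K) (mfps N K)
  (mfps_partial i) (mfps_partial_is_zmod_morphism i).

Fact mfps_euler_is_zmod_morphism i : zmod_morphism (mfps_euler i).
Proof. by move=> f g; apply: funext => a; rewrite [LHS]mulrBr. Qed.
HB.instance Definition _ i := GRing.isZmodMorphism.Build (mfps N K) (mfps N K)
  (mfps_euler i) (mfps_euler_is_zmod_morphism i).

End PowerSeries.

(* A[lambda, 1/lambda] is the localization of {poly A} at 'X: the pair (p, k)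
   stands for p / 'X^k. *)
Section Laurent.
Variable A : comNzRingType.
Local Notation lpair := ({poly A} * nat)%type.
Implicit Types (u v w : lpair).

Definition laurent_rel u v := u.1 * 'X^(v.2) == v.1 * 'X^(u.2).

Fact mulXn_inj n : injective (fun p : {poly A} => p * 'X^n).
Proof. exact: (monic_rreg (monicXn A n)). Qed.

Fact laurent_rel_refl : reflexive laurent_rel.
Proof. by move=> u; rewrite /laurent_rel. Qed.
Fact laurent_rel_sym : ssrbool.symmetric laurent_rel.
Proof. by move=> u v; rewrite /laurent_rel eq_sym. Qed.
Fact laurent_rel_trans : transitive laurent_rel.
Proof.
move=> v u w /eqP uv /eqP vw; apply/eqP; apply: (@mulXn_inj v.2) => /=.
by rewrite mulrAC uv mulrAC vw mulrAC.
Qed.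

Canonical laurent_equiv :=
  EquivRel laurent_rel laurent_rel_refl laurent_rel_sym laurent_rel_trans.

Definition laurent := {eq_quot laurent_rel}.

HB.instance Definition _ : EqQuotient _ laurent_rel laurent :=
  EqQuotient.on laurent.
HB.instance Definition _ := Choice.on laurent.

Fact laurent_eq u v : (\pi_laurent u = \pi_laurent v) <-> u.1 * 'X^(v.2) = v.1 * 'X^(u.2).
Proof. by split=> [/eqmodP/eqP | uv]; last by apply/eqmodP/eqP. Qed.

Fact laurent_reprE u :
  (repr (\pi_laurent u)).1 * 'X^(u.2) = u.1 * 'X^((repr (\pi_laurent u)).2).
Proof. by apply/laurent_eq; rewrite reprK. Qed.

Definition lpair_add u v : lpair :=
  (u.1 * 'X^(v.2) + v.1 * 'X^(u.2), (u.2 + v.2)%N).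
Definition laurent_add := lift_op2 laurent lpair_add.
Fact pi_laurent_add :
  {morph \pi : u v / lpair_add u v >-> laurent_add u v}.
Proof.
move=> u v; unlock laurent_add; apply/laurent_eq => /=; rewrite !exprD.
have := laurent_reprE u; have := laurent_reprE v.
move: (repr (\pi_laurent v)) (repr (\pi_laurent u)) => v' u' hv hu.
transitivity ((u.1 * 'X^(u'.2)) * ('X^(v.2) * 'X^(v'.2))
            + (v.1 * 'X^(v'.2)) * ('X^(u.2) * 'X^(u'.2))); first by ring.
by rewrite -hu -hv; ring.
Qed.
Canonical pi_laurent_add_morph := PiMorph2 pi_laurent_add.

Definition lpair_opp u : lpair := (- u.1, u.2).
Definition laurent_opp := lift_op1 laurent lpair_opp.
Fact pi_laurent_opp : {morph \pi : u / lpair_opp u >-> laurent_opp u}.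
Proof.
move=> u; unlock laurent_opp; apply/laurent_eq => /=.
by rewrite !mulNr laurent_reprE.
Qed.
Canonical pi_laurent_opp_morph := PiMorph1 pi_laurent_opp.

Definition lpair_mul u v : lpair := (u.1 * v.1, (u.2 + v.2)%N).
Definition laurent_mul := lift_op2 laurent lpair_mul.
Fact pi_laurent_mul :
  {morph \pi : u v / lpair_mul u v >-> laurent_mul u v}.
Proof.
move=> u v; unlock laurent_mul; apply/laurent_eq => /=; rewrite !exprD.
by rewrite [LHS]mulrACA -!laurent_reprE mulrACA.
Qed.
Canonical pi_laurent_mul_morph := PiMorph2 pi_laurent_mul.

Definition polyL (p : {poly A}) : laurent := \pi_laurent (p, 0%N).

Fact laurent_addA : associative laurent_add.
Proof.
elim/quotW=> u; elim/quotW=> v; elim/quotW=> w; rewrite !piE.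
by apply/laurent_eq; rewrite /= !exprD; ring.
Qed.
Fact laurent_addC : commutative laurent_add.
Proof.
elim/quotW=> u; elim/quotW=> v; rewrite !piE.
by apply/laurent_eq; rewrite /= !exprD; ring.
Qed.
Fact laurent_add0 : left_id (polyL 0) laurent_add.
Proof.
elim/quotW=> u; rewrite /polyL !piE.
by apply/laurent_eq; rewrite /= !add0n; ring.
Qed.
Fact laurent_addN : left_inverse (polyL 0) laurent_opp laurent_add.
Proof.
elim/quotW=> u; rewrite /polyL !piE.
by apply/laurent_eq; rewrite /= !exprD; ring.
Qed.

HB.instance Definition _ := GRing.isZmodule.Build laurent
  laurent_addA laurent_addC laurent_add0 laurent_addN.

Fact laurent_mulA : associative laurent_mul.
Proof.
elim/quotW=> u; elim/quotW=> v; elim/quotW=> w; rewrite !piE.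
by apply/laurent_eq; rewrite /= !exprD; ring.
Qed.
Fact laurent_mulC : commutative laurent_mul.
Proof.
elim/quotW=> u; elim/quotW=> v; rewrite !piE.
by apply/laurent_eq; rewrite /= !exprD; ring.
Qed.
Fact laurent_mul1 : left_id (polyL 1) laurent_mul.
Proof.
elim/quotW=> u; rewrite /polyL !piE.
by apply/laurent_eq; rewrite /= !add0n; ring.
Qed.
Fact laurent_mulDl : left_distributive laurent_mul laurent_add.
Proof.
elim/quotW=> u; elim/quotW=> v; elim/quotW=> w; rewrite !piE.
by apply/laurent_eq; rewrite /= !exprD; ring.
Qed.
Fact laurent_nonzero1 : polyL 1 != 0.
Proof.
by apply/eqP => /laurent_eq /=; rewrite !mulr1; apply/eqP; exact: oner_neq0.
Qed.

HB.instance Definition _ := GRing.Zmodule_isComNzRing.Build laurent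
  laurent_mulA laurent_mulC laurent_mul1 laurent_mulDl laurent_nonzero1.

Fact polyL_is_zmod_morphism : zmod_morphism polyL.
Proof.
move=> p q; rewrite /polyL -[X in _ = _ + X]pi_laurent_opp -[RHS]pi_laurent_add.
by apply/laurent_eq; rewrite /= !addn0; ring.
Qed.
HB.instance Definition _ :=
  GRing.isZmodMorphism.Build {poly A} laurent polyL polyL_is_zmod_morphism.

Fact polyL_is_monoid_morphism : monoid_morphism polyL.
Proof. by split=> // p q; rewrite /polyL -[RHS]pi_laurent_mul. Qed.
HB.instance Definition _ :=
  GRing.isMonoidMorphism.Build {poly A} laurent polyL polyL_is_monoid_morphism.

Definition laurent_scale (p : {poly A}) (x : laurent) : laurent := polyL p * x.
Fact laurent_scaleA p q x :
  laurent_scale p (laurent_scale q x) = laurent_scale (p * q) x.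
Proof. by rewrite /laurent_scale rmorphM mulrA. Qed.
Fact laurent_scale1 : left_id 1 laurent_scale.
Proof. by move=> x; rewrite /laurent_scale rmorph1 mul1r. Qed.
Fact laurent_scaleDr : right_distributive laurent_scale +%R.
Proof. by move=> p x y; rewrite /laurent_scale mulrDr. Qed.
Fact laurent_scaleDl x : {morph laurent_scale^~ x : p q / p + q}.
Proof. by move=> p q; rewrite /laurent_scale rmorphD mulrDl. Qed.

HB.instance Definition _ := GRing.Zmodule_isLmodule.Build {poly A} laurent
  laurent_scaleA laurent_scale1 laurent_scaleDr laurent_scaleDl.

(* lambda ^ k *)
Definition laurentX (k : int) : laurent :=
  match k with Posz j => \pi_laurent ('X^j, 0%N) | Negz j => \pi_laurent (1, j.+1) end.

Definition lpair_coef u (i : int) : A :=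
  if i + u.2%:Z is Posz j then u.1`_j else 0.
Definition laurent_coef (x : laurent) (i : int) : A := lpair_coef (repr x) i.

Fact lpair_coefX u n i : lpair_coef u i = lpair_coef (u.1 * 'X^n, (u.2 + n)%N) i.
Proof.
rewrite /lpair_coef /= PoszD addrA; case: (i + _) => [j|j].
  by rewrite -PoszD coefMXn ltnNge leq_addl /= addnK.
case e: (_ + _) => [l|//]; rewrite coefMXn ifT //.
by move: e; rewrite NegzE; lia.
Qed.

Fact laurent_coefE u i : laurent_coef (\pi u) i = lpair_coef u i.
Proof.
rewrite /laurent_coef (lpair_coefX _ (u.2)) laurent_reprE.
by rewrite [RHS](lpair_coefX _ (repr (\pi_laurent u)).2) addnC.
Qed.

Definition laurent_res (x : laurent) : A := laurent_coef x (-1).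

Fact laurent_resD x y : laurent_res (x + y) = laurent_res x + laurent_res y.
Proof.
elim/quotW: x => u; elim/quotW: y => v.
have -> : \pi_laurent u + \pi_laurent v = \pi_laurent (lpair_add u v).
  by rewrite pi_laurent_add.
rewrite /laurent_res !laurent_coefE (lpair_coefX u (v.2)).
rewrite (lpair_coefX v (u.2)) [(v.2 + _)%N]addnC /lpair_coef /=.
by case: (_ + _) => [j|j]; rewrite ?coefD ?addr0.
Qed.

Fact laurent_res_polyL p : laurent_res (polyL p) = 0.
Proof. by rewrite /laurent_res /polyL laurent_coefE. Qed.

Fact laurentXM k : laurentX (k - 1) * polyL 'X = laurentX k.
Proof.
have pm u v : \pi_laurent u * \pi_laurent v = \pi_laurent (lpair_mul u v).
  by rewrite pi_laurent_mul.
case: k => [[|k]|k].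
- by rewrite /polyL /= pm; apply/laurent_eq; rewrite /= !expr1 !expr0; ring.
- rewrite (_ : _ - 1 = k%:Z); last by lia.
  by rewrite /polyL /= pm; apply/laurent_eq; rewrite /= exprSr.
rewrite (_ : _ - 1 = Negz k.+1); last by lia.
by rewrite /polyL /= pm; apply/laurent_eq; rewrite /= addn0 !exprS; ring.
Qed.

(* lambda d/dlambda, that is p / 'X^k |-> ('X p' - k p) / 'X^k *)
Definition laurent_euler (x : laurent) : laurent :=
  let u := repr x in \pi_laurent ('X * u.1^`() - u.1 *+ u.2, u.2).

Fact laurent_eulerE u :
  laurent_euler (\pi u) = \pi_laurent ('X * u.1^`() - u.1 *+ u.2, u.2).
Proof.
rewrite /laurent_euler; have := laurent_reprE u; move: (repr _) => v.
case: u v => [p k] [q l] /= qp; apply/laurent_eq => /=.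
have XdX n : 'X * ('X^n)^`() = 'X^n * n%:R :> {poly A}.
  rewrite derivXn mulrnAr mulr_natr.
  by case: n => [|n]; rewrite ?mulr0n // -exprS.
have dqp : 'X * q^`() * 'X^k + q * ('X^k * k%:R)
         = 'X * p^`() * 'X^l + p * ('X^l * l%:R).
  have := congr1 (fun r => 'X * r^`()) qp; rewrite /= !derivM -!XdX => e.
  transitivity ('X * (q^`() * 'X^k + q * ('X^k)^`())); first by ring.
  by rewrite e; ring.
rewrite -[q *+ l]mulr_natr -[p *+ k]mulr_natr.
transitivity (('X * q^`() * 'X^k + q * ('X^k * k%:R))
  - (q * 'X^k) * (k%:R + l%:R)); first by ring.
by rewrite dqp qp; ring.
Qed.

End Laurent.

Section LaurentMap.
Variables A B : comNzRingType.

(* Coefficientwise; meant for additive f. *)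
Definition laurent_map (f : A -> B) (x : laurent A) : laurent B :=
  let u := repr x in \pi_(laurent B) (map_poly f u.1, u.2).

Fact laurent_mapE (f : {additive A -> B}) (u : {poly A} * nat) :
  laurent_map f (\pi_(laurent A) u) = \pi_(laurent B) (map_poly f u.1, u.2).
Proof.
rewrite /laurent_map; have := laurent_reprE u; move: (repr _) => v vu.
have mapX (p : {poly A}) k : map_poly f p * 'X^k = map_poly f (p * 'X^k).
  apply/polyP => i; rewrite coefMXn !coef_map coefMXn.
  by case: ifP; rewrite ?raddf0.
by apply/laurent_eq; rewrite /= !mapX vu.
Qed.

End LaurentMap.

(* A free module with basis theta_0, ..., theta_(N-1) acting on A by
   derivations is identified with 'rV[A]_N; nabla is the flat connection which
   kills this basis. *)
Section Connection.
Variables (A : comNzRingType) (N : nat) (theta : 'I_N -> A -> A).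
Implicit Types x y : 'rV[A]_N.

Definition vf_act x (f : A) : A := \sum_i x 0 i * theta i f.
Definition nabla x y : 'rV[A]_N := map_mx (vf_act x) y.
Definition bracket x y : 'rV[A]_N := nabla x y - nabla y x.

End Connection.

Section Reduction.
Variables (A : comNzRingType) (N : nat).

(* Reduction modulo lambda. *)
Definition red0 (x : 'rV[{poly A}]_N) : 'rV[A]_N :=
  map_mx (fun p : {poly A} => p`_0) x.

Definition induced_mul (mul : 'rV[{poly A}]_N -> 'rV[{poly A}]_N -> 'rV[{poly A}]_N)
    (x y : 'rV[A]_N) : 'rV[A]_N :=
  red0 (mul (map_mx polyC x) (map_mx polyC y)).

Fact red0_split (x : 'rV[{poly A}]_N) :
  x = 'X *: map_mx (drop_poly 1) x + map_mx polyC (red0 x).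
Proof.
apply/matrixP => i j; rewrite !mxE.
rewrite -[LHS](poly_take_drop 1) addrC mulrC expr1; congr (_ + _).
by apply/polyP => k; rewrite coef_take_poly coefC; case: k.
Qed.

Fact red0_XD (x y : 'rV[{poly A}]_N) : red0 ('X *: x + y) = red0 y.
Proof. by apply/matrixP => i j; rewrite !mxE coefD coefXM add0r. Qed.

Fact induced_mulE mul : bilinear_for *:%R *:%R mul ->
  forall x y, red0 (mul x y) = induced_mul mul (red0 x) (red0 y).
Proof.
move=> [mulL mulR] x y; rewrite {1}[x]red0_split.
have -> : mul ('X *: map_mx (drop_poly 1) x + map_mx polyC (red0 x)) y
  = 'X *: mul (map_mx (drop_poly 1) x) y + mul (map_mx polyC (red0 x)) y.
  exact: mulL.
by rewrite red0_XD {1}[y]red0_split mulR red0_XD.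
Qed.

End Reduction.

Section Filtrations.
Variables (K : fieldType) (V : vectType K).

Fact subspace_ex_vspace (P : V -> Prop) :
  P 0 -> (forall a x y, P x -> P y -> P (a *: x + y)) ->
  exists U : {vspace V}, forall x, x \in U <-> P x.
Proof.
move=> P0 Plin.
pose sub (U : {vspace V}) := forall x, x \in U -> P x.
pose Q d := `[< exists2 U, sub U & \dim U = d >].
have Q0 : exists d, Q d.
  exists 0%N; apply/asboolP; exists 0%VS; last exact: dimv0.
  by move=> x; rewrite memv0 => /eqP ->.
have Qbound d : Q d -> (d <= \dim {:V})%N.
  by case/asboolP => U _ <-; exact: dimvS (subvf U).
case: (ex_maxnP Q0 Qbound) => d /asboolP[U subU dimU] maxd.
exists U => x; split=> [|Px]; first exact: subU.
have subUx : sub (<[x]> + U)%VS.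
  move=> y /memv_addP[_ /vlineP[a ->] [u uU ->]].
  by apply: Plin => //; exact: subU.
have /maxd : Q (\dim (<[x]> + U)%VS) by apply/asboolP; exists (<[x]> + U)%VS.
rewrite -dimU => dimle; have [_] := dimv_leqif_sup (addvSr <[x]> U).
rewrite eqn_leq dimle dimvS ?addvSr // => /esym/subvP; apply.
by apply: (subvP (addvSl _ _)); exact: memv_line.
Qed.

(* The metric on I_k / I_(k-1) is given as its pull-back to I_k. *)
Record nondegenerate_filtration (I : int -> {vspace V})
    (g : forall k, subvs_of (I k) -> subvs_of (I k) -> K) : Prop := {
  nf_increasing : forall k l : int, (k <= l)%R -> (I k <= I l)%VS;
  nf_exhaustive : exists l : int, forall k, (l <= k)%R -> I k = fullv;
  nf_bounded : exists l : int, forall k, (k <= l)%R -> I k = 0%VS;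
  nf_bilinear : forall k, bilinear_for *%R *%R (g k);
  nf_symmetric : forall k x y, g k x y = g k y x;
  nf_descends : forall k x y, vsval x \in I (k - 1) -> g k x y = 0;
  nf_nondegenerate :
    forall k x, (forall y, g k x y = 0) -> vsval x \in I (k - 1) }.

End Filtrations.

Arguments nondegenerate_filtration {K V} I g.

Section LocalizedMetric.
Variables (K : fieldType) (N : nat).
Local Notation HL := 'rV[{poly K}]_N.

Record localized_metric := LocalizedMetric {
  lmetric :> HL -> HL -> laurent K;
  lmetric_bilinear : bilinear_for *:%R *:%R lmetric;
  lmetric_sym : forall x y, lmetric x y = lmetric y x;
  lmetric_nondegenerate :
    let G := \matrix_(i < N, j < N) lmetric (delta_mx 0 i) (delta_mx 0 j) in
    exists B : 'M[laurent K]_N, G *m B = 1%:M /\ B *m G = 1%:M }.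

Variable g : localized_metric.

(* The submodule I_k^lambda. *)
Definition lambda_filt (k : int) (x : HL) : Prop :=
  forall y, exists p : {poly K}, laurentX K k * g x y = polyL p.

Fact lmetricPl p x y z : g (p *: x + y) z = polyL p * g x z + g y z.
Proof. by case: (lmetric_bilinear g) => gl _; exact: gl. Qed.

Fact lmetric0l z : g 0 z = 0.
Proof.
have := lmetricPl (-1) 0 0 z; rewrite scaler0 addr0 => ->.
by rewrite rmorphN rmorph1 mulN1r addNr.
Qed.

Fact lambda_filt0 k : lambda_filt k 0.
Proof. by move=> z; exists 0; rewrite lmetric0l mulr0 rmorph0. Qed.

Fact lambda_filtZD k p x y :
  lambda_filt k x -> lambda_filt k y -> lambda_filt k (p *: x + y).
Proof.
move=> xk yk z; have [q xq] := xk z; have [r yr] := yk z.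
by exists (p * q + r); rewrite lmetricPl mulrDr mulrCA xq yr rmorphD rmorphM.
Qed.

Fact induced_filt_ex (k : int) : exists U : {vspace 'rV[K]_N},
  forall x, x \in U <-> exists2 X, lambda_filt k X & red0 X = x.
Proof.
apply: subspace_ex_vspace => [|a x y [X Xk <-] [Y Yk <-]].
  exists 0; first exact: lambda_filt0.
  by apply/matrixP => i j; rewrite !mxE coef0.
exists (a%:P *: X + Y); first exact: lambda_filtZD.
by apply/matrixP => i j; rewrite !mxE coefD coefCM.
Qed.

Definition induced_filt (k : int) : {vspace 'rV[K]_N} :=
  projT1 (cid (induced_filt_ex k)).

Fact induced_filtP k x :
  x \in induced_filt k <-> exists2 X, lambda_filt k X & red0 X = x.
Proof. exact: (projT2 (cid (induced_filt_ex k))). Qed.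

Definition induced_lift k (x : subvs_of (induced_filt k)) : HL :=
  s2val (cid2 ((induced_filtP k (vsval x)).1 (valP x))).

Fact induced_liftP k (x : subvs_of (induced_filt k)) :
  lambda_filt k (induced_lift x) /\ red0 (induced_lift x) = vsval x.
Proof. by rewrite /induced_lift; case: cid2. Qed.

Definition induced_metric k (x y : subvs_of (induced_filt k)) : K :=
  laurent_res (laurentX K (k - 1) * g (induced_lift x) (induced_lift y)).

(* The residue does not depend on the lifts. *)
Fact induced_metricE k (x y : subvs_of (induced_filt k)) X Y :
  lambda_filt k X -> red0 X = vsval x -> lambda_filt k Y -> red0 Y = vsval y ->
  induced_metric x y = laurent_res (laurentX K (k - 1) * g X Y).
Proof.
have key X1 X2 Z : red0 X1 = red0 X2 -> lambda_filt k Z ->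
    laurent_res (laurentX K (k - 1) * g X1 Z)
    = laurent_res (laurentX K (k - 1) * g X2 Z).
  move=> X12 Zk; rewrite [X1]red0_split [X2]red0_split X12 !lmetricPl.
  have van W : exists p, laurentX K (k - 1) * (polyL 'X * g W Z) = polyL p.
    have [p Zp] := Zk W; exists p; rewrite mulrA -Zp lmetric_sym.
    by congr (_ * _); rewrite laurentXM.
  by rewrite !mulrDr !laurent_resD; congr (_ + _);
     have [p ->] := van (map_mx (drop_poly 1) X1);
     have [q ->] := van (map_mx (drop_poly 1) X2);
     rewrite !laurent_res_polyL.
move=> Xk Xx Yk Yy; have [Lx xE] := induced_liftP x.
have [Ly yE] := induced_liftP y; rewrite /induced_metric.
rewrite (key _ X _ _ Ly) ?Xx ?xE // !(lmetric_sym g X).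
by rewrite (key _ Y _ _ Xk) // Yy yE.
Qed.

End LocalizedMetric.

Arguments induced_metric {K N} g k x y.

Section ScalarExtension.
Variables (K : fieldType) (N : nat) (U : {vspace 'rV[K]_N}).
Local Notation R := (mfps N K).

Definition flat (x : 'rV[K]_N) : 'rV[R]_N := map_mx (@mfpsC N K) x.

(* Membership in the submodule R (x) U of R^N. *)
Definition in_ext (x : 'rV[R]_N) : Prop :=
  exists c : 'I_(\dim U) -> R, x = \sum_i c i *: flat (vbasis U)`_i.

(* [vsproj U] is a projection onto U, so on R (x) U this is the R-bilinear
   extension of f; the values elsewhere are irrelevant. *)
Definition form_ext (f : subvs_of U -> subvs_of U -> K) (x y : 'rV[R]_N) : R :=
  \sum_i \sum_j x 0 i * y 0 j
     * mfpsC (f (vsproj U (delta_mx 0 i)) (vsproj U (delta_mx 0 j))).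

Fact form_extE f (r s : R) (u v : subvs_of U) : bilinear_for *%R *%R f ->
  form_ext f (r *: flat (vsval u)) (s *: flat (vsval v)) = r * s * mfpsC (f u v).
Proof.
move=> [fl fr].
have fDl a x y z : f (a *: x + y) z = a * f x z + f y z by exact: fl.
have fDr a x y z : f z (a *: x + y) = a * f z x + f z y by exact: fr.
have f0l z : f 0 z = 0.
  by have := fDl (-1) 0 0 z; rewrite scaler0 addr0 => ->; rewrite mulN1r addNr.
have f0r z : f z 0 = 0.
  by have := fDr (-1) 0 0 z; rewrite scaler0 addr0 => ->; rewrite mulN1r addNr.
have uE (w : subvs_of U) : w = \sum_i vsval w 0 i *: vsproj U (delta_mx 0 i).
  rewrite -[LHS]vsvalK {1}[vsval w]row_sum_delta linear_sum.
  by apply: eq_bigr => i _; rewrite linearZ.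
have fsuml (c : 'I_N -> K) (b : 'I_N -> subvs_of U) z :
    f (\sum_i c i *: b i) z = \sum_i c i * f (b i) z.
  by elim/big_rec2: _ => [|i y x _ <-]; rewrite ?f0l ?fDl.
have fsumr (c : 'I_N -> K) (b : 'I_N -> subvs_of U) z :
    f z (\sum_i c i *: b i) = \sum_i c i * f z (b i).
  by elim/big_rec2: _ => [|i y x _ <-]; rewrite ?f0r ?fDr.
rewrite [in RHS](uE u) fsuml rmorph_sum mulr_sumr /form_ext.
apply: eq_bigr => i _; rewrite [in RHS](uE v) fsumr mulr_sumr rmorph_sum mulr_sumr.
by apply: eq_bigr => j _; rewrite !mxE !rmorphM; ring.
Qed.

End ScalarExtension.

Section Structures.
Variables (K : fieldType) (n m : nat).

(* The coordinates t are the first n variables and q the last m ones.  The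
   formal spectrum of R has a single point, so the sheaves on it are replaced by
   their global sections: T = R (x) H is the module of logarithmic vector
   fields, and TL = T (x) K[lambda]. *)
Local Notation R := (mfps (n + m) K).
Local Notation T := 'rV[R]_(n + m).
Local Notation TL := 'rV[{poly R}]_(n + m).
Local Notation H := 'rV[K]_(n + m).
Local Notation HL := 'rV[{poly K}]_(n + m).

(* d/dt_i for i < n and q_j d/dq_j for i = n + j. *)
Definition log_partial (i : 'I_(n + m)) : R -> R :=
  match split i with inl _ => mfps_partial i | inr _ => mfps_euler i end.

Fact log_partial_is_zmod_morphism i : zmod_morphism (log_partial i).
Proof. by rewrite /log_partial; case: split => _ f g; rewrite raddfB. Qed.
HB.instance Definition _ i := GRing.isZmodMorphism.Build R R
  (log_partial i) (log_partial_is_zmod_morphism i).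

Definition log_partialL (i : 'I_(n + m)) : {poly R} -> {poly R} :=
  map_poly (log_partial i).

Local Notation nablaT := (nabla log_partial).
Local Notation bracketT := (bracket log_partial).
Local Notation nablaTL := (nabla log_partialL).
Local Notation bracketTL := (bracket log_partialL).

Definition flatL (x : HL) : TL := map_mx (map_poly (@mfpsC (n + m) K)) x.

(* [E + lambda d/dlambda, x] *)
Definition bracket_euler (E x : TL) : TL :=
  bracketTL E x + map_mx (fun p : {poly R} => 'X * p^`()) x.

(* (E + lambda d/dlambda) f *)
Definition act_euler (E : TL) (f : laurent R) : laurent R :=
  \sum_i polyL (E 0 i) * laurent_map (log_partial i) f + laurent_euler f.

Definition lmetric_ext (g : localized_metric K (n + m)) (x y : TL) : laurent R :=
  \sum_i \sum_j polyL (x 0 i * y 0 j)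
     * laurent_map (@mfpsC (n + m) K) (g (delta_mx 0 i) (delta_mx 0 j)).

Record localized_frobenius (D : K) (mul : TL -> TL -> TL) (E : TL)
    (g : localized_metric K (n + m)) : Prop := {
  lf_bilinear : bilinear_for *:%R *:%R mul;
  lf_assoc : associative mul;
  lf_comm : commutative mul;
  lf_potential : forall x y z : HL,
    nablaTL (flatL x) (mul (flatL y) (flatL z))
    = nablaTL (flatL y) (mul (flatL x) (flatL z));
  lf_unit : exists e, left_id e mul /\ forall x, nablaTL x e = 0;
  lf_euler_flat : forall x y : HL, nablaTL (flatL x) (nablaTL (flatL y) E) = 0;
  lf_euler_mul : forall x y,
    bracket_euler E (mul x y) - mul x (bracket_euler E y)
      - mul (bracket_euler E x) y = mul x y;
  lf_invariant : forall x y z,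
    lmetric_ext g (mul x y) z = lmetric_ext g x (mul y z);
  lf_euler_metric : forall x y,
    act_euler E (lmetric_ext g x y) - lmetric_ext g (bracket_euler E x) y
      - lmetric_ext g x (bracket_euler E y)
    = polyL (mfpsC (2 - D))%:P * lmetric_ext g x y }.

Record saito (mul : T -> T -> T) (E : T) : Prop := {
  st_bilinear : bilinear_for *:%R *:%R mul;
  st_assoc : associative mul;
  st_comm : commutative mul;
  st_potential : forall x y z : H,
    nablaT (flat x) (mul (flat y) (flat z))
    = nablaT (flat y) (mul (flat x) (flat z));
  st_unit : exists e, left_id e mul /\ forall x, nablaT x e = 0;
  st_euler_flat : forall x y : H, nablaT (flat x) (nablaT (flat y) E) = 0;
  st_euler_mul : forall x y,
    bracketT E (mul x y) - mul x (bracketT E y) - mul (bracketT E x) y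
    = mul x y }.

(* g_k is used through its pull-back to I_k, as in [nondegenerate_filtration].
   Only the charges D k with I_(k-1) <> I_k matter. *)
Record mixed_frobenius (D : int -> K) (mul : T -> T -> T) (E : T)
    (I : int -> {vspace H}) (g : forall k, subvs_of (I k) -> subvs_of (I k) -> K)
    : Prop := {
  mf_saito : saito mul E;
  mf_filtration : nondegenerate_filtration I g;
  mf_ideal : forall k x y, in_ext (I k) y -> in_ext (I k) (mul x y);
  mf_invariant : forall k x y z, in_ext (I k) y -> in_ext (I k) z ->
    form_ext (g k) (mul x y) z = form_ext (g k) y (mul x z);
  mf_euler_stable : forall k x, in_ext (I k) x -> in_ext (I k) (bracketT E x);
  mf_euler_metric : forall k x y, I (k - 1) <> I k ->
    in_ext (I k) x -> in_ext (I k) y ->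
    vf_act log_partial E (form_ext (g k) x y) - form_ext (g k) (bracketT E x) y
      - form_ext (g k) x (bracketT E y)
    = mfpsC (2 - D k) * form_ext (g k) x y }.

End Structures.

Arguments mixed_frobenius {K n m} D mul E I g.

(* Main.v *)
(* Write the localized metric in powers of lambda.  Membership of x in
   I_k^lambda says that the series g(x, .) start at lambda^(-k), and g_k is
   their coefficient at lambda^(-k).  Since * is g-invariant, it preserves
   R (x) I_k^lambda; since lambda d/dlambda does not lower the order of a
   Laurent polynomial, so does [E^lambda, .]; on the coefficient at
   lambda^(-k), E + lambda d/dlambda acts as E - k, which accounts for the
   shift of the charge.  Reducing modulo lambda gives the axioms.

   Nondegeneracy of g_k: if x in I_k^lambda is g_k-orthogonal to I_k, then
   y |-> coef_(-k) g(x, y) vanishes on I_k^lambda, which is the common kernel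
   of finitely many functionals y |-> coef_(-k-1-j) g(e_i, y)
   = coef_(-k) g(lambda^(j+1) e_i, y).  Hence it is equal to
   coef_(-k) g(lambda z, .) for some z, and x - lambda z is a lift of
   x mod lambda in I_(k-1)^lambda. *)
From HB Require Import structures.
Require Import Defs.
From mathcomp Require Import all_boot all_order all_algebra.
From mathcomp Require Import reals complex.
From mathcomp Require Import sesquilinear boolp mpoly ring zify.

Set Implicit Arguments.
Unset Strict Implicit.
Unset Printing Implicit Defensive.

Import Order.TTheory GRing.Theory Num.Theory.
Local Open Scope ring_scope.
Local Open Scope quotient_scope.

(** * Coefficients and lambda-adic order of Laurent polynomials *)

Section LaurentCoef.
Variable A : comNzRingType.
Implicit Types (x y : laurent A) (p q : {poly A}) (i k v w : int).

Lemma laurent_coefD x y i :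
  laurent_coef (x + y) i = laurent_coef x i + laurent_coef y i.
Proof.
elim/quotW: x => u; elim/quotW: y => z.
have -> : \pi_(laurent A) u + \pi_(laurent A) z
    = \pi_(laurent A) (lpair_add u z) by rewrite pi_laurent_add.
rewrite !laurent_coefE (lpair_coefX u (z.2)) (lpair_coefX z (u.2)).
rewrite [(z.2 + _)%N]addnC /lpair_coef /=.
by case: (_ + _) => [j|j]; rewrite ?coefD ?addr0.
Qed.

Lemma laurent_coefB x y i :
  laurent_coef (x - y) i = laurent_coef x i - laurent_coef y i.
Proof. by apply: (addIr (laurent_coef y i)); rewrite -laurent_coefD !subrK. Qed.

Lemma laurent_coef0 i : laurent_coef (0 : laurent A) i = 0.
Proof. by rewrite -(subrr 0) laurent_coefB subrr. Qed.

Lemma laurent_coef_sum (I : Type) (r : seq I) (F : I -> laurent A) i :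
  laurent_coef (\sum_(j <- r) F j) i = \sum_(j <- r) laurent_coef (F j) i.
Proof.
by apply: (big_morph (fun x => laurent_coef x i)) => [x y|];
  rewrite ?laurent_coefD ?laurent_coef0.
Qed.

Lemma laurent_coef_polyL p i :
  laurent_coef (polyL p) i = if i is Posz j then p`_j else 0.
Proof. by rewrite /polyL laurent_coefE /lpair_coef /= addr0. Qed.

Lemma laurent_piM (u z : {poly A} * nat) :
  \pi_(laurent A) u * \pi_(laurent A) z = \pi_(laurent A) (lpair_mul u z).
Proof. by rewrite pi_laurent_mul. Qed.

Lemma laurent_eq_coef x y :
  (forall i, laurent_coef x i = laurent_coef y i) -> x = y.
Proof.
elim/quotW: x => u; elim/quotW: y => z xy; apply/laurent_eq.
(* Over the common denominator ['X^(u.2 + z.2)], this degree picks out the [j]-th coefficient of the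
   cross-multiplied numerators. *)
apply/polyP => j; have := xy (j%:Z - u.2%:Z - z.2%:Z).
rewrite !laurent_coefE (lpair_coefX u z.2) (lpair_coefX z u.2) /lpair_coef /=.
rewrite [(z.2 + _)%N]addnC PoszD.
by rewrite (_ : _ - _ - _ + _ = j%:Z) //; ring.
Qed.

Lemma laurent_coefXM k x i :
  laurent_coef (laurentX A k * x) i = laurent_coef x (i - k).
Proof.
elim/quotW: x => u; case: k => k.
  rewrite [laurentX _ _]/= laurent_piM !laurent_coefE /lpair_coef /= add0n.
  case: (leP 0 (i + u.2%:Z)) => [|lt0].
    case e: (_ + _) => [j|//] _; rewrite mulrC coefMXn.
    case: ltnP => [lt|le]; case e': (_ + _) => [l|l] //; last by lia.
      by lia.
    by congr (_`_ _); lia.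
  case e: (_ + _) => [j|j]; first by lia.
  by case e': (_ + _) => [l|l] //; lia.
rewrite [laurentX _ _]/= laurent_piM !laurent_coefE /lpair_coef /= mul1r.
by rewrite (_ : i + _ = i - Negz k + u.2) // NegzE PoszD; ring.
Qed.

Lemma laurent_coefCM (c : A) x i :
  laurent_coef (polyL c%:P * x) i = c * laurent_coef x i.
Proof.
elim/quotW: x => u; rewrite /polyL laurent_piM !laurent_coefE /lpair_coef /=.
by rewrite add0n; case: (_ + _) => j; rewrite ?coefCM ?mulr0.
Qed.

Lemma polyLXn j : polyL 'X^j = laurentX A j%:Z.
Proof. by []. Qed.

Lemma laurentX_XN k x : laurentX A (- k) * (laurentX A k * x) = x.
Proof. by apply: laurent_eq_coef => i; rewrite !laurent_coefXM opprK addrK. Qed.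

(** A lower bound for the order at lambda = 0; as a condition on coefficients it also covers 0,
    which satisfies every bound. *)
Definition laurent_ge v x := forall i, i < v -> laurent_coef x i = 0.

Lemma laurent_ge0 v : laurent_ge v 0.
Proof. by move=> i _; rewrite laurent_coef0. Qed.

Lemma laurent_geD v x y :
  laurent_ge v x -> laurent_ge v y -> laurent_ge v (x + y).
Proof. by move=> xv yv i iv; rewrite laurent_coefD xv ?yv ?addr0. Qed.

Lemma laurent_geB v x y :
  laurent_ge v x -> laurent_ge v y -> laurent_ge v (x - y).
Proof. by move=> xv yv i iv; rewrite laurent_coefB xv ?yv ?subr0. Qed.

Lemma laurent_ge_sum v (I : Type) (r : seq I) (F : I -> laurent A) :
  (forall j, laurent_ge v (F j)) -> laurent_ge v (\sum_(j <- r) F j).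
Proof.
move=> Fv; elim/big_rec: _ => [|j x _ xv]; first exact: laurent_ge0.
exact: laurent_geD.
Qed.

Lemma laurent_ge_trans v w x : w <= v -> laurent_ge v x -> laurent_ge w x.
Proof. by move=> wv xv i iw; rewrite xv // (lt_le_trans iw). Qed.

Lemma laurent_ge_polyP x : laurent_ge 0 x <-> exists p, x = polyL p.
Proof.
split=> [|[p ->] [j|j] //]; last by rewrite laurent_coef_polyL.
(* The first [k] coefficients of [p] are those of [x] in negative degree, hence 0, so dropping them
   divides [p] by ['X^k]. *)
elim/quotW: x => -[p k] x0; exists (drop_poly k p).
apply: laurent_eq_coef => -[j|j]; rewrite laurent_coef_polyL; last exact: x0.
by rewrite laurent_coefE /lpair_coef /= coef_drop_poly.
Qed.

Lemma laurent_geXM k v x :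
  laurent_ge v (laurentX A k * x) <-> laurent_ge (v - k) x.
Proof.
split=> xv i iv; last by rewrite laurent_coefXM xv // ltrBrDr subrK.
have := xv (i + k); rewrite laurent_coefXM addrK; apply.
by rewrite -ltrBrDr.
Qed.

Lemma laurent_geP v x :
  laurent_ge v x <-> exists p, laurentX A (- v) * x = polyL p.
Proof. by rewrite -laurent_ge_polyP laurent_geXM sub0r opprK. Qed.

(** The terms of [p] other than its constant term push [x] to order above [v]. This is why the
    lowest coefficient depends only on reductions modulo lambda. *)
Lemma laurent_ge_polyLM v p x : laurent_ge v x ->
  laurent_ge v (polyL p * x) /\
  laurent_coef (polyL p * x) v = p`_0 * laurent_coef x v.
Proof.
elim/poly_ind: p => [|p c IHp] xv.
  rewrite rmorph0 mul0r coef0 mul0r laurent_coef0.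
  by split=> //; exact: laurent_ge0.
have [pv _] := IHp xv.
have -> : polyL (p * 'X + c%:P) * x
    = laurentX A 1 * (polyL p * x) + polyL c%:P * x.
  by rewrite rmorphD rmorphM mulrDl mulrA [laurentX A 1 * _]mulrC.
have lt1 i : i - 1 < i by rewrite ltrBlDr ltrDl.
split=> [i iv|]; rewrite laurent_coefD laurent_coefXM laurent_coefCM.
  by rewrite pv ?xv ?mulr0 ?addr0 // (lt_trans (lt1 i)).
by rewrite pv // add0r coefD coefMX coefC add0r.
Qed.

Lemma laurent_geM v w x y :
  laurent_ge v x -> laurent_ge w y -> laurent_ge (v + w) (x * y).
Proof.
move=> xv /laurent_geP[p yp]; have -> : y = laurentX A w * polyL p.
  by rewrite -yp -{1}[w]opprK laurentX_XN.
rewrite mulrCA [x * _]mulrC; apply/laurent_geXM; rewrite addrK.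
by case: (laurent_ge_polyLM p xv).
Qed.

Lemma laurent_ge_ex x : exists d : nat, laurent_ge (- d%:Z) x.
Proof.
elim/quotW: x => u; exists u.2 => i; rewrite laurent_coefE /lpair_coef.
by case e: (_ + _) => [j|//] lt; lia.
Qed.

(** A uniform bound on pole orders, meant for the entries of the Gram matrix and of its inverse. *)
Lemma laurent_ge_bound (I : finType) (F : I -> laurent A) :
  exists d : nat, forall j, laurent_ge (- d%:Z) (F j).
Proof.
pose d j := projT1 (cid (laurent_ge_ex (F j))).
exists (\max_j d j)%N => j.
apply: laurent_ge_trans (projT2 (cid (laurent_ge_ex (F j)))).
by rewrite lerN2 lez_nat; exact: (leq_bigmax j).
Qed.

Lemma laurent_coef_euler x i :
  laurent_coef (laurent_euler x) i = laurent_coef x i *~ i.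
Proof.
elim/quotW: x => -[p k]; rewrite laurent_eulerE !laurent_coefE /lpair_coef /=.
case e: (_ + _) => [j|//]; last by rewrite mul0rz.
have -> : i = j%:Z - k%:Z by lia.
rewrite coefB coefXM coefMn mulrzBr -!pmulrn.
by case: j {e} => [|j]; rewrite ?mulr0n // coef_deriv.
Qed.

End LaurentCoef.

(** * Functionals vanishing on a finite intersection of kernels *)

Section FiniteIntersectionOfKernels.
Variables (K : fieldType) (V : lmodType {poly K}).

(** Only K-linearity: taking one coefficient in lambda does not commute with multiplication by
    lambda. *)
Definition scalar_linear (f : V -> K) :=
  forall a x y, f (a%:P *: x + y) = a * f x + f y.

(* A functional vanishing on the common kernel of finitely many others is in
   their span; P stands for membership in the span. *)
Lemma kernel_span_ind (I : eqType) (tau : I -> V -> K) (P : (V -> K) -> Prop)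
    (s : seq I) (phi : V -> K) :
  P (fun=> 0) ->
  (forall a i f, P f -> P (fun x => a * tau i x + f x)) ->
  (forall i, scalar_linear (tau i)) -> scalar_linear phi ->
  (forall x, (forall i, i \in s -> tau i x = 0) -> phi x = 0) ->
  P phi.
Proof.
move=> P0 PD tauL; elim: s phi => [|i s IHs] phi phiL ker.
  by have -> : phi = fun=> 0 by apply: funext => x; exact: ker.
have [[v [sv iv]]|nov] := pselect (exists v,
    (forall j, j \in s -> tau j v = 0) /\ tau i v <> 0); last first.
  apply: IHs => // x sx; apply: ker => j; rewrite inE => /predU1P[->|/sx //].
  by apply: contrapT => ix; apply: nov; exists x.
move/eqP in iv; pose a := phi v / tau i v.
have phiE : phi = fun x => a * tau i x + (phi x - a * tau i x).
  by apply: funext => x; rewrite addrC subrK.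
rewrite phiE; apply: (PD _ _ (fun x => phi x - a * tau i x)).
apply: IHs => [b x y|x sx]; first by rewrite phiL tauL; ring.
(* Correcting [x] by a multiple of [v] brings it into the kernel of [tau i] without leaving the
   kernels of [s]. *)
have /eqP : phi ((- (tau i x / tau i v))%:P *: v + x) = 0.
  apply: ker => j; rewrite inE tauL => /predU1P[->|js].
    by rewrite mulNr divfK // addNr.
  by rewrite (sv j) // (sx j) // mulr0 addr0.
rewrite phiL mulNr addrC subr_eq0 => /eqP ->.
by rewrite mulrAC [tau i x * _]mulrC mulrAC subrr.
Qed.

End FiniteIntersectionOfKernels.

Lemma red0ZD (A : comNzRingType) N a (X Y : 'rV[{poly A}]_N) :
  red0 (a%:P *: X + Y) = a *: red0 X + red0 Y.
Proof. by apply/rowP => i; rewrite !mxE coefD coefCM. Qed.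

Lemma red0_polyC (A : comNzRingType) N (x : 'rV[A]_N) :
  red0 (map_mx polyC x) = x.
Proof. by apply/rowP => i; rewrite !mxE coefC. Qed.

(** * The nondegenerate filtration induced by a localized metric *)

Section InducedFiltration.
Variables (K : fieldType) (N : nat) (g : localized_metric K N).
Local Notation HL := 'rV[{poly K}]_N.
Local Notation e i := (delta_mx 0 i : HL).
Implicit Types (X Y Z : HL) (k : int).

Lemma lmetricPr p X Y Z : g Z (p *: X + Y) = polyL p * g Z X + g Z Y.
Proof. by rewrite lmetric_sym lmetricPl !(lmetric_sym g Z). Qed.

Lemma lmetricZl p X Y : g (p *: X) Y = polyL p * g X Y.
Proof. by rewrite -[p *: X]addr0 lmetricPl lmetric0l addr0. Qed.

Lemma lmetric_expandr X Y : g X Y = \sum_j polyL (Y 0 j) * g X (e j).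
Proof.
rewrite {1}[Y]row_sum_delta; elim/big_rec2: _ => [|j z Z _ <-].
  by rewrite lmetric_sym lmetric0l.
by rewrite lmetricPr.
Qed.

Lemma lmetric_expand X Y :
  g X Y = \sum_i \sum_j polyL (X 0 i * Y 0 j) * g (e i) (e j).
Proof.
rewrite lmetric_sym lmetric_expandr; apply: eq_bigr => i _.
rewrite lmetric_sym lmetric_expandr mulr_sumr; apply: eq_bigr => j _.
by rewrite mulrA -rmorphM.
Qed.

Lemma lambda_filtP k X :
  lambda_filt g k X <-> forall Y, laurent_ge (- k) (g X Y).
Proof.
split=> Xk Y; first by apply/laurent_geP; rewrite opprK; exact: Xk.
by have /laurent_geP := Xk Y; rewrite opprK.
Qed.

Lemma lambda_filt_delta k X :
  (forall j, laurent_ge (- k) (g X (e j))) -> lambda_filt g k X.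
Proof.
move=> Xk; apply/lambda_filtP => Y; rewrite lmetric_expandr.
by apply: laurent_ge_sum => j; case: (laurent_ge_polyLM (Y 0 j) (Xk j)).
Qed.

Lemma lambda_filt_le k l X : k <= l -> lambda_filt g k X -> lambda_filt g l X.
Proof.
move=> kl /lambda_filtP Xk; apply/lambda_filtP => Y.
by apply: laurent_ge_trans (Xk Y); rewrite lerN2.
Qed.

Lemma lambda_filt_exhaustive :
  exists l, forall k X, l <= k -> lambda_filt g k X.
Proof.
have [d gd] := laurent_ge_bound (fun ij : 'I_N * 'I_N => g (e ij.1) (e ij.2)).
exists d%:Z => k X dk; apply: (lambda_filt_le dk); apply/lambda_filtP => Y.
rewrite lmetric_expand; apply: laurent_ge_sum => i; apply: laurent_ge_sum => j.
by case: (laurent_ge_polyLM (X 0 i * Y 0 j) (gd (i, j))).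
Qed.

(** The inverse Gram matrix recovers the coordinates of [X] from its pairings with the basis. If
    these vanish to an order exceeding the poles of the inverse, all coordinates are divisible by
    lambda. *)
Lemma lambda_filt_bounded :
  exists l, forall k X, k <= l -> lambda_filt g k X -> red0 X = 0.
Proof.
have [B [GB _]] := lmetric_nondegenerate g.
have [d Bd] := laurent_ge_bound (fun ij : 'I_N * 'I_N => B ij.1 ij.2).
(* The pairings then have order at least [d + 1] and the entries of [B] at least [- d], so the
   products have order at least 1. *)
exists (- d%:Z - 1) => k X kd /lambda_filtP Xk.
apply/rowP => i; rewrite !mxE.
have XE : polyL (X 0 i) = \sum_j g X (e j) * B j i.
  under eq_bigr => j _.
    rewrite lmetric_sym lmetric_expandr mulr_suml.
    under eq_bigr => l _ do rewrite lmetric_sym -mulrA.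
    over.
  rewrite exchange_big /= (bigD1 i) //= -mulr_sumr.
  have GBE j l : \sum_m g (e j) (e m) * B m l = (j == l)%:R.
    have := congr1 (fun M : 'M[laurent K]_N => M j l) GB; rewrite !mxE => <-.
    by apply: eq_bigr => m _; rewrite !mxE.
  rewrite GBE eqxx mulr1 big1 ?addr0 // => l li.
  by rewrite -mulr_sumr GBE (negbTE li) mulr0.
have -> : (X 0 i)`_0 = laurent_coef (polyL (X 0 i)) 0.
  by rewrite laurent_coef_polyL.
rewrite XE laurent_coef_sum big1 // => j _.
by apply: (laurent_geM (Xk (e j)) (Bd (j, i))) => /=; lia.
Qed.

(** Multiplying by lambda^(k-1) moves the coefficient at lambda^(-k) to lambda^(-1), where the
    residue reads it. *)
Lemma induced_metric_coef k (x y : subvs_of (induced_filt g k)) X Y :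
  lambda_filt g k X -> red0 X = vsval x ->
  lambda_filt g k Y -> red0 Y = vsval y ->
  induced_metric g k x y = laurent_coef (g X Y) (- k).
Proof.
move=> Xk Xx Yk Yy; rewrite (induced_metricE Xk Xx Yk Yy).
by rewrite /laurent_res laurent_coefXM; congr (laurent_coef _ _); ring.
Qed.

Lemma induced_metric_sym k (x y : subvs_of (induced_filt g k)) :
  induced_metric g k x y = induced_metric g k y x.
Proof. by rewrite /induced_metric lmetric_sym. Qed.

Lemma induced_metricPl k a (x y z : subvs_of (induced_filt g k)) :
  induced_metric g k (a *: x + y) z
  = a * induced_metric g k x z + induced_metric g k y z.
Proof.
have [[Xk Xx] [Yk Yy] [Zk Zz]] :=
  And3 (induced_liftP x) (induced_liftP y) (induced_liftP z).
rewrite (induced_metric_coef Xk Xx Zk Zz) (induced_metric_coef Yk Yy Zk Zz).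
have XYk := lambda_filtZD a%:P Xk Yk.
rewrite (induced_metric_coef XYk _ Zk Zz) ?red0ZD ?Xx ?Yy ?linearP //.
by rewrite lmetricPl laurent_coefD laurent_coefCM.
Qed.

Lemma induced_metric_bilinear k : bilinear_for *%R *%R (induced_metric g k).
Proof.
by split=> z a x y; rewrite ?(induced_metric_sym z) induced_metricPl.
Qed.

Lemma induced_nondegenerate k (x : subvs_of (induced_filt g k)) :
  (forall y, induced_metric g k x y = 0) -> vsval x \in induced_filt g (k - 1).
Proof.
move=> x0; have [Xk Xx] := induced_liftP x.
move: (induced_lift x) Xk Xx => X Xk Xx.
have [d gd] := lambda_filt_exhaustive.
pose tau (ij : 'I_N * nat) Y := laurent_coef (g Y (e ij.1)) (- k - 1 - ij.2%:Z).
(* Pairings with multiples of lambda contain the span of the [tau], since [tau (i, j)] is the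
   coefficient at lambda^(-k) of the pairing with lambda^(j+1) e_i. *)
pose P (f : HL -> K) :=
  exists Z, f = fun Y => laurent_coef (g ('X *: Z) Y) (- k).
pose phi Y := laurent_coef (g X Y) (- k).
have [] : P phi.
  (* All pairings have order at least [- d], so only the degrees from [- d] to [- k - 1] have to be
     tested. *)
  pose s := [seq (i, j) | i <- enum 'I_N, j <- iota 0 `|d - k|%N].
  apply: (@kernel_span_ind _ _ _ tau P s).
  - exists 0; apply: funext => Y.
    by rewrite scaler0 lmetric0l laurent_coef0.
  - move=> a [i j] _ [Z ->]; exists ((a%:P * 'X^j) *: e i + Z).
    apply: funext => Y; rewrite scalerDr scalerA mulrCA lmetricPl.
    rewrite laurent_coefD rmorphM -mulrA laurent_coefCM -exprS /=.
    rewrite polyLXn laurent_coefXM (lmetric_sym g (e i)).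
    congr (_ * laurent_coef _ _ + _).
    by rewrite /=; lia.
  - by move=> i a Y Z; rewrite /tau lmetricPl laurent_coefD laurent_coefCM.
  - by move=> a Y Z; rewrite /phi lmetricPr laurent_coefD laurent_coefCM.
  (* The tests in [s] force [Y] into I_k^lambda; the orthogonality of [x] to I_k then applies to
     [red0 Y]. *)
  move=> Y Ys; have Yk : lambda_filt g k Y.
    apply: lambda_filt_delta => i l lk.
    have [ld|dl] := ltP l (- d).
      by have /lambda_filtP := gd d Y (lexx _); apply.
    have := Ys (i, `|(- k - 1 - l)%R|%N); rewrite /tau /=.
    rewrite (_ : - k - 1 - `|(- k - 1 - l)%R|%N%:Z = l); last by lia.
    apply; apply/allpairsP; exists (i, `|(- k - 1 - l)%R|%N).
    by rewrite mem_enum mem_iota; split=> //=; lia.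
  have Yf : red0 Y \in induced_filt g k by apply/induced_filtP; exists Y.
  have [y Yy] : exists y : subvs_of (induced_filt g k), red0 Y = vsval y.
    by exists (Subvs Yf).
  by rewrite -(x0 y) (induced_metric_coef Xk Xx Yk Yy).
move=> Z phiE; have coef0 Y : laurent_coef (g (- 'X *: Z + X) Y) (- k) = 0.
  have := congr1 (fun f => f Y) phiE; rewrite /phi => /= XZ.
  rewrite lmetricPl laurent_coefD XZ -laurent_coefD lmetricZl rmorphN mulNr.
  by rewrite addNr laurent_coef0.
apply/induced_filtP; exists (- 'X *: Z + X); last first.
  by rewrite scaleNr -scalerN red0_XD.
apply/lambda_filtP => Y i ik.
(* Here [i <= - k], so lambda^(-k-i) is a polynomial; multiplying [Y] by it moves the coefficient at
   [i] to [- k]. *)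
have := coef0 ('X^(`|(- k - i)%R|%N) *: Y); rewrite lmetric_sym lmetricZl.
rewrite polyLXn laurent_coefXM lmetric_sym => <-.
by congr (laurent_coef _ _); lia.
Qed.

Lemma induced_nondegenerate_filtration :
  nondegenerate_filtration (induced_filt g) (induced_metric g).
Proof.
split.
- move=> k l kl; apply/subvP => x /induced_filtP[X Xk Xx].
  by apply/induced_filtP; exists X => //; exact: lambda_filt_le Xk.
- have [l gl] := lambda_filt_exhaustive; exists l => k lk; apply/vspaceP => x.
  rewrite memvf; apply/induced_filtP; exists (map_mx polyC x); first exact: gl.
  exact: red0_polyC.
- have [l gl] := lambda_filt_bounded; exists l => k kl; apply/vspaceP => x.
  rewrite memv0; apply/idP/eqP => [/induced_filtP[X Xk <-]|->].
    exact: gl kl Xk.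
  exact: mem0v.
- exact: induced_metric_bilinear.
- by move=> k x y; exact: induced_metric_sym.
- move=> k x y /induced_filtP[X Xk Xx].
  have [Yk Yy] := induced_liftP y.
  (* A lift in I_(k-1)^lambda is also a lift in I_k^lambda, and its pairings start only at
     lambda^(1-k). *)
  rewrite (induced_metric_coef (lambda_filt_le _ Xk) Xx Yk Yy) ?gerBl //.
  by have /lambda_filtP := Xk; apply; lia.
- exact: induced_nondegenerate.
Qed.

End InducedFiltration.

(** * Base change of Laurent polynomials and coefficients of power series *)

Section LaurentMapCoef.
Variables A B : comNzRingType.

Lemma laurent_coef_map (f : {additive A -> B}) (x : laurent A) i :
  laurent_coef (laurent_map f x) i = f (laurent_coef x i).
Proof.
elim/quotW: x => u; rewrite laurent_mapE !laurent_coefE /lpair_coef /=.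
by case: (_ + _) => j; rewrite ?coef_map ?raddf0.
Qed.

Lemma laurent_map_polyLM (f : {rmorphism A -> B}) p (x : laurent A) :
  laurent_map f (polyL p * x) = polyL (map_poly f p) * laurent_map f x.
Proof.
elim/quotW: x => u; rewrite /polyL laurent_piM !laurent_mapE laurent_piM /=.
by rewrite /lpair_mul /= rmorphM.
Qed.

End LaurentMapCoef.

Section MonomialCoefficient.
Variables (N : nat) (K : comNzRingType) (a : 'X_{1..N}).
Local Notation R := (mfps N K).

(** Named so as to carry an additive structure. It commutes with multiplication by constants of K
    and serves to bring statements over R down to K, one monomial at a time. *)
Definition mfps_at (f : R) : K := f a.

Lemma mfps_at_is_zmod_morphism : zmod_morphism mfps_at.
Proof. by []. Qed.
HB.instance Definition _ :=
  GRing.isZmodMorphism.Build R K mfps_at mfps_at_is_zmod_morphism.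

Lemma mfps_atMC (f : R) c : mfps_at (f * mfpsC c) = mfps_at f * c.
Proof.
have agC : mfps_agree (mdeg a).+1 (mfpsC c) (c%:MP : {mpoly K[N]}).
  by move=> b _; rewrite mcoeffC /mfpsC; case: eqP; rewrite ?(mulr1, mulr0).
rewrite /mfps_at [LHS](mfps_agreeM (@mfps_truncP _ _ (mdeg a).+1 f) agC) //.
by rewrite mulrC mcoeffCM mulrC -mfps_truncP.
Qed.

Lemma map_mfps_atM (p : {poly R}) (q : {poly K}) :
  map_poly mfps_at (p * map_poly (@mfpsC N K) q) = map_poly mfps_at p * q.
Proof.
apply/polyP => i; rewrite coef_map !coefM raddf_sum.
by apply: eq_bigr => j _; rewrite !coef_map /= mfps_atMC.
Qed.

Lemma laurent_coef_at (p : {poly R}) (x : laurent K) i :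
  mfps_at (laurent_coef (polyL p * laurent_map (@mfpsC N K) x) i)
  = laurent_coef (polyL (map_poly mfps_at p) * x) i.
Proof.
elim/quotW: x => u; rewrite laurent_mapE /polyL !laurent_piM !laurent_coefE.
rewrite /lpair_coef /lpair_mul /=; case: (_ + _) => j; rewrite ?raddf0 //.
by rewrite -map_mfps_atM coef_map.
Qed.

End MonomialCoefficient.

(** * Subspaces and forms extended from K to R *)

Section ScalarExtensionTheory.
Variables (K : fieldType) (N : nat) (U : {vspace 'rV[K]_N}).
Local Notation R := (mfps N K).
Implicit Types (x y : 'rV[R]_N) (f : subvs_of U -> subvs_of U -> K).

(** The coordinates of the coefficients of [x] in the finite basis [vbasis U] assemble, monomial by
    monomial, into the series [c i]. *)
Lemma in_ext_at x : (forall a, map_mx (mfps_at a) x \in U) -> in_ext U x.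
Proof.
move=> xU; pose c i : R := fun a => coord (vbasis U) i (map_mx (mfps_at a) x).
exists c; apply/rowP => j; apply: funext => a.
transitivity (map_mx (mfps_at a) x 0 j); first by rewrite mxE.
rewrite {1}(coord_vbasis (xU a)) !summxE -[RHS]/(mfps_at a _) raddf_sum.
apply: eq_bigr => i _.
by rewrite !mxE /= mfps_atMC.
Qed.

Lemma form_extDl f z : {morph (form_ext f)^~ z : x y / x + y}.
Proof.
move=> x y; rewrite -big_split; apply: eq_bigr => i _ /=.
by rewrite -big_split; apply: eq_bigr => j _; rewrite /= mxE !mulrDl.
Qed.

Lemma form_extDr f z : {morph form_ext f z : x y / x + y}.
Proof.
move=> x y; rewrite -big_split; apply: eq_bigr => i _ /=.
by rewrite -big_split; apply: eq_bigr => j _; rewrite /= mxE mulrDr !mulrDl.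
Qed.

Lemma form_ext0l f z : form_ext f 0 z = 0.
Proof. by apply: (addrI (form_ext f 0 z)); rewrite -form_extDl !addr0. Qed.

Lemma form_ext0r f z : form_ext f z 0 = 0.
Proof. by apply: (addrI (form_ext f z 0)); rewrite -form_extDr !addr0. Qed.

Lemma form_ext_suml f z (I : Type) (r : seq I) (F : I -> 'rV[R]_N) :
  form_ext f (\sum_(i <- r) F i) z = \sum_(i <- r) form_ext f (F i) z.
Proof. exact: (big_morph _ (form_extDl f z) (form_ext0l f z)). Qed.

Lemma form_ext_sumr f z (I : Type) (r : seq I) (F : I -> 'rV[R]_N) :
  form_ext f z (\sum_(i <- r) F i) = \sum_(i <- r) form_ext f z (F i).
Proof. exact: (big_morph _ (form_extDr f z) (form_ext0r f z)). Qed.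

End ScalarExtensionTheory.

(** * The localized metric over R and lifts of R (x) I_k *)

Section ExtendedMetric.
Variables (K : fieldType) (n m : nat) (g : localized_metric K (n + m)).
Local Notation N := (n + m)%N.
Local Notation R := (mfps N K).
Local Notation TL := 'rV[{poly R}]_N.
Local Notation HL := 'rV[{poly K}]_N.
Local Notation gext := (@lmetric_ext K n m g).
Implicit Types (X Y Z : TL) (k : int).

Lemma lmetric_ext_sym X Y : gext X Y = gext Y X.
Proof.
rewrite /lmetric_ext exchange_big /=; apply: eq_bigr => i _.
by apply: eq_bigr => j _; rewrite [X 0 j * _]mulrC lmetric_sym.
Qed.

Lemma lmetric_extPl p X Y Z :
  gext (p *: X + Y) Z = polyL p * gext X Z + gext Y Z.
Proof.
rewrite /lmetric_ext mulr_sumr -big_split; apply: eq_bigr => i _ /=.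
rewrite mulr_sumr -big_split; apply: eq_bigr => j _ /=.
by rewrite !mxE mulrDl rmorphD -mulrA !rmorphM; ring.
Qed.

Lemma lmetric_ext0l Z : gext 0 Z = 0.
Proof.
by do 2!rewrite /lmetric_ext big1 // => ? _; rewrite mxE mul0r rmorph0 mul0r.
Qed.

Lemma lmetric_ext_suml (I : Type) (r : seq I) (c : I -> {poly R})
    (F : I -> TL) Z :
  gext (\sum_(i <- r) c i *: F i) Z = \sum_(i <- r) polyL (c i) * gext (F i) Z.
Proof.
elim/big_rec2: _ => [|i z Y _ <-]; first exact: lmetric_ext0l.
by rewrite lmetric_extPl.
Qed.

Lemma lmetric_ext_sumr (I : Type) (r : seq I) (c : I -> {poly R})
    (F : I -> TL) Z :
  gext Z (\sum_(i <- r) c i *: F i) = \sum_(i <- r) polyL (c i) * gext Z (F i).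
Proof.
rewrite lmetric_ext_sym lmetric_ext_suml.
by apply: eq_bigr => i _; rewrite lmetric_ext_sym.
Qed.

Lemma lmetric_ext_flat (X Y : HL) :
  gext (flatL X) (flatL Y) = laurent_map (@mfpsC N K) (g X Y).
Proof.
apply: laurent_eq_coef => l; rewrite laurent_coef_map lmetric_expand.
rewrite !laurent_coef_sum raddf_sum; apply: eq_bigr => i _.
rewrite !laurent_coef_sum raddf_sum; apply: eq_bigr => j _.
by rewrite -laurent_coef_map laurent_map_polyLM [in RHS]rmorphM !mxE.
Qed.

Lemma lmetric_ext_at a X (Y : HL) l :
  mfps_at a (laurent_coef (gext X (flatL Y)) l)
  = laurent_coef (g (map_mx (map_poly (mfps_at a)) X) Y) l.
Proof.
rewrite lmetric_expand !laurent_coef_sum raddf_sum; apply: eq_bigr => i _.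
rewrite !laurent_coef_sum raddf_sum; apply: eq_bigr => j _ /=.
by rewrite laurent_coef_at !mxE map_mfps_atM.
Qed.

(** This plays the part of R (x) I_k^lambda. Testing against all of [TL] makes stability under
    operations adjoint for [gext] immediate. *)
Definition ext_filt k X := forall Y, laurent_ge (- k) (gext X Y).

Lemma ext_filt_flat k (X : HL) : lambda_filt g k X -> ext_filt k (flatL X).
Proof.
move=> /lambda_filtP Xk Y.
have -> : Y = \sum_j Y 0 j *: flatL (delta_mx 0 j).
  rewrite {1}[Y]row_sum_delta; apply: eq_bigr => j _; congr (_ *: _).
  by apply/matrixP => i l; rewrite !mxE rmorph_nat.
rewrite lmetric_ext_sumr; apply: laurent_ge_sum => j.
apply: (proj1 (laurent_ge_polyLM _ _)) => i ik.
by rewrite lmetric_ext_flat laurent_coef_map (Xk _ _ ik) raddf0.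
Qed.

(** Pairing with flat vectors commutes with taking the coefficient of a monomial, so each such
    coefficient of [X] lies in I_k^lambda and reduces into I_k. *)
Lemma ext_filt_red0 k X : ext_filt k X -> in_ext (induced_filt g k) (red0 X).
Proof.
move=> Xk; apply: in_ext_at => a; apply/induced_filtP.
exists (map_mx (map_poly (mfps_at a)) X).
  by apply/lambda_filtP => Y i ik; rewrite -lmetric_ext_at Xk.
by apply/rowP => i; rewrite !mxE coef_map.
Qed.

Section Lift.
Variables (k : int) (c : 'I_(\dim (induced_filt g k)) -> R).
Local Notation U := (induced_filt g k).
Local Notation b i := (vsproj U (vbasis U)`_i).

(** A lift of the combination of [vbasis U] with coefficients [c]: basis vectors are lifted over K,
    and [c] stays constant in lambda. *)
Definition ext_lift : TL := \sum_i (c i)%:P *: flatL (induced_lift (b i)).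

Lemma vsval_vbasis (i : 'I_(\dim U)) : vsval (b i) = (vbasis U)`_i.
Proof. by rewrite vsprojK // vbasis_mem // mem_nth // size_tuple. Qed.

Lemma ext_lift_filt : ext_filt k ext_lift.
Proof.
move=> Y; rewrite lmetric_ext_suml; apply: laurent_ge_sum => i.
apply: (proj1 (laurent_ge_polyLM _ _)); apply: ext_filt_flat.
by case: (induced_liftP (b i)).
Qed.

Lemma red0_ext_lift : red0 ext_lift = \sum_i c i *: flat (vbasis U)`_i.
Proof.
apply/rowP => j; rewrite !mxE !summxE coef_sum; apply: eq_bigr => i _.
have [_ bE] := induced_liftP (b i); rewrite -[in RHS]vsval_vbasis -bE.
by rewrite !mxE coefCM coef_map.
Qed.

End Lift.

Lemma in_ext_lift k x : in_ext (induced_filt g k) x ->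
  exists c : 'I_(\dim (induced_filt g k)) -> R, x = red0 (ext_lift c).
Proof. by move=> [c ->]; exists c; rewrite red0_ext_lift. Qed.

Lemma form_ext_lift k (c d : 'I_(\dim (induced_filt g k)) -> R) :
  form_ext (induced_metric g k) (red0 (ext_lift c)) (red0 (ext_lift d))
  = laurent_coef (gext (ext_lift c) (ext_lift d)) (- k).
Proof.
rewrite !red0_ext_lift form_ext_suml lmetric_ext_suml laurent_coef_sum.
apply: eq_bigr => i _; rewrite form_ext_sumr laurent_coefCM lmetric_ext_sumr.
rewrite laurent_coef_sum mulr_sumr; apply: eq_bigr => j _.
rewrite -[in LHS](vsval_vbasis i) -[in LHS](vsval_vbasis j).
rewrite form_extE ?laurent_coefCM; last exact: induced_metric_bilinear.
rewrite lmetric_ext_flat laurent_coef_map mulrA.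
have [[Xk Xx] [Yk Yy]] :=
  (induced_liftP (vsproj (induced_filt g k) (vbasis (induced_filt g k))`_i),
   induced_liftP (vsproj (induced_filt g k) (vbasis (induced_filt g k))`_j)).
by rewrite (induced_metric_coef Xk Xx Yk Yy).
Qed.

(** Two lifts differ by a multiple of lambda, whose pairing with [Z] has order above [- k]. *)
Lemma lmetric_ext_red0 k X Y Z : red0 X = red0 Y -> ext_filt k Z ->
  laurent_coef (gext X Z) (- k) = laurent_coef (gext Y Z) (- k).
Proof.
move=> XY Zk; rewrite [X]red0_split [Y]red0_split XY !lmetric_extPl.
have van W : laurent_coef (polyL 'X * gext W Z) (- k) = 0.
  by rewrite lmetric_ext_sym (laurent_ge_polyLM _ (Zk W)).2 coefX mul0r.
by rewrite !laurent_coefD !van.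
Qed.

(** The formula holds for the lifts [ext_lift] by bilinearity. They are exchanged for [X] and [Y]
    one at a time, the other argument staying in [ext_filt]. *)
Lemma form_ext_coef k X Y : ext_filt k X -> ext_filt k Y ->
  form_ext (induced_metric g k) (red0 X) (red0 Y)
  = laurent_coef (gext X Y) (- k).
Proof.
move=> Xk Yk; have [c Xc] := in_ext_lift (ext_filt_red0 Xk).
have [d Yd] := in_ext_lift (ext_filt_red0 Yk).
rewrite Xc Yd form_ext_lift (lmetric_ext_red0 (esym Xc) (@ext_lift_filt k d)).
by rewrite !(lmetric_ext_sym X) (lmetric_ext_red0 (esym Yd) Xk).
Qed.

Lemma in_ext_filt k x : in_ext (induced_filt g k) x ->
  exists2 X, ext_filt k X & x = red0 X.
Proof.
by case/in_ext_lift=> c ->; exists (ext_lift c) => //; exact: ext_lift_filt.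
Qed.

End ExtendedMetric.

(** * Reduction modulo lambda of the connection and the Euler field *)

Section Reduction.
Variables (K : fieldType) (n m : nat).
Local Notation N := (n + m)%N.
Local Notation R := (mfps N K).
Local Notation TL := 'rV[{poly R}]_N.
Local Notation dT := (@log_partial K n m).
Local Notation dTL := (@log_partialL K n m).
Implicit Types (X Y E : TL).

Lemma red0_nabla X Y : red0 (nabla dTL X Y) = nabla dT (red0 X) (red0 Y).
Proof.
apply/rowP => j; rewrite !mxE coef_sum; apply: eq_bigr => i _.
by rewrite !mxE coef0M coef_map.
Qed.

Lemma red0D X Y : red0 (X + Y) = red0 X + red0 Y.
Proof. by apply/rowP => j; rewrite !mxE coefD. Qed.

Lemma red0B X Y : red0 (X - Y) = red0 X - red0 Y.
Proof. by apply/rowP => j; rewrite !mxE coefB. Qed.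

Lemma red0_flat (x : 'rV[K]_N) : red0 (flatL (map_mx polyC x)) = flat x.
Proof. by apply/rowP => j; rewrite !mxE coef_map coefC. Qed.

(** The contribution of lambda d/dlambda is divisible by lambda and disappears. *)
Lemma red0_bracket_euler E X :
  red0 (bracket_euler E X) = bracket dT (red0 E) (red0 X).
Proof.
rewrite /bracket_euler red0D /bracket red0B !red0_nabla -[RHS]addr0.
by congr (_ + _); apply/rowP => j; rewrite !mxE coefXM.
Qed.

(** Only the constant term of [E] in lambda reaches the lowest coefficient, on which lambda
    d/dlambda is multiplication by [v]. *)
Lemma act_euler_coef E (x : laurent R) v : laurent_ge v x ->
  laurent_ge v (act_euler E x) /\
  laurent_coef (act_euler E x) v
  = vf_act dT (red0 E) (laurent_coef x v) + laurent_coef x v *~ v.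
Proof.
move=> xv; have dv i : laurent_ge v (laurent_map (dT i) x).
  by move=> l lv; rewrite laurent_coef_map xv ?raddf0.
split.
  apply: laurent_geD => [|l lv]; last by rewrite laurent_coef_euler xv ?mul0rz.
  by apply: laurent_ge_sum => i; case: (laurent_ge_polyLM (E 0 i) (dv i)).
rewrite laurent_coefD laurent_coef_euler laurent_coef_sum; congr (_ + _).
apply: eq_bigr => i _.
by rewrite (laurent_ge_polyLM (E 0 i) (dv i)).2 laurent_coef_map mxE.
Qed.

End Reduction.

(** * The axioms of a mixed Frobenius structure *)

Section Proposition.
Variables (K : fieldType) (n m : nat) (D : K).
Local Notation N := (n + m)%N.
Local Notation R := (mfps N K).
Local Notation TL := 'rV[{poly R}]_N.
Variables (mul : TL -> TL -> TL) (E : TL) (g : localized_metric K N).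
Hypothesis lf : localized_frobenius D mul E g.
Local Notation gext := (@lmetric_ext K n m g).
Local Notation mul0 := (induced_mul mul).
Local Notation bracketT := (bracket (@log_partial K n m)).
Local Notation lift x := (map_mx (@polyC R) x).

Lemma red0_mul X Y : red0 (mul X Y) = mul0 (red0 X) (red0 Y).
Proof. exact: induced_mulE (lf_bilinear lf) X Y. Qed.

(** Each axiom is the reduction of its counterpart over K[lambda], applied to lifts constant in
    lambda. *)
Lemma induced_saito : saito mul0 (red0 E).
Proof.
have mul0C : commutative mul0.
  by move=> x y; rewrite /induced_mul (lf_comm lf).
split=> //.
- have mul0Pl a x y z : mul0 (a *: x + y) z = a *: mul0 x z + mul0 y z.
    rewrite -[in LHS](red0_polyC x) -[in LHS](red0_polyC y).
    rewrite -[in LHS](red0_polyC z).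
    have [mulL _] := lf_bilinear lf.
    rewrite -red0ZD -red0_mul [mul _ _](mulL (lift z)) red0ZD !red0_mul.
    by rewrite !red0_polyC.
  by split=> z a x y; rewrite ?(mul0C z) mul0Pl.
- move=> x y z; rewrite -[x]red0_polyC -[y]red0_polyC -[z]red0_polyC.
  by rewrite -!red0_mul (lf_assoc lf).
- move=> x y z; rewrite -!red0_flat -!red0_mul -!red0_nabla.
  by rewrite (lf_potential lf).
- have [e [e1 flat_e]] := lf_unit lf; exists (red0 e); split=> x.
    by rewrite -[x]red0_polyC -red0_mul e1.
  rewrite -[x]red0_polyC -red0_nabla flat_e.
  by apply/rowP => i; rewrite !mxE coef0.
- move=> x y; rewrite -!red0_flat -!red0_nabla (lf_euler_flat lf).
  by apply/rowP => i; rewrite !mxE coef0.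
- move=> x y; rewrite -[x]red0_polyC -[y]red0_polyC.
  rewrite -!red0_mul -!red0_bracket_euler -!red0_mul -!red0B.
  by rewrite (lf_euler_mul lf).
Qed.

(** Invariance moves [X] to the other argument, which [ext_filt] leaves arbitrary. *)
Lemma ext_filt_mul k X Y : ext_filt g k Y -> ext_filt g k (mul X Y).
Proof. by move=> Yk Z; rewrite (lf_comm lf) (lf_invariant lf). Qed.

Lemma lmetric_ext_euler X Y :
  gext (bracket_euler E X) Y = act_euler E (gext X Y)
    - gext X (bracket_euler E Y) - polyL (mfpsC (2 - D))%:P * gext X Y.
Proof. by rewrite -(lf_euler_metric lf); ring. Qed.

(** Once the metric axiom is solved for this bracket, every other term pairs [X] itself, and
    [act_euler] does not lower the order. *)
Lemma ext_filt_euler k X : ext_filt g k X -> ext_filt g k (bracket_euler E X).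
Proof.
move=> Xk Y; rewrite lmetric_ext_euler; apply: laurent_geB.
  by apply: laurent_geB => //; case: (act_euler_coef E (Xk Y)).
by case: (laurent_ge_polyLM (mfpsC (2 - D))%:P (Xk Y)).
Qed.

Lemma form_ext_euler k X Y : ext_filt g k X -> ext_filt g k Y ->
  let x := red0 X in let y := red0 Y in let gk := induced_metric g k in
  vf_act (@log_partial K n m) (red0 E) (form_ext gk x y)
    - form_ext gk (bracketT (red0 E) x) y - form_ext gk x (bracketT (red0 E) y)
  = mfpsC (2 - (D - k%:~R)) * form_ext gk x y.
Proof.
move=> Xk Yk x y gk; rewrite -!red0_bracket_euler.
have [EXk EYk] := (ext_filt_euler Xk, ext_filt_euler Yk).
rewrite !form_ext_coef // lmetric_ext_euler !laurent_coefB laurent_coefCM.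
(* At order [- k] the derivation lambda d/dlambda contributes [- k] times the coefficient; moved to
   the right, it turns [2 - D] into [2 - (D - k)]. *)
rewrite (act_euler_coef E (Xk Y)).2 mulrNz -mulrzl.
have -> : mfpsC (2 - (D - k%:~R)) = mfpsC (2 - D) + k%:~R :> R.
  by rewrite -(rmorph_int (@mfpsC N K)) -rmorphD opprB addrA addrAC.
by ring.
Qed.

Lemma induced_mixed_frobenius :
  mixed_frobenius (fun k : int => D - k%:~R) mul0 (red0 E)
    (induced_filt g) (induced_metric g).
Proof.
split.
- exact: induced_saito.
- exact: induced_nondegenerate_filtration.
- move=> k x _ /in_ext_filt[Y Yk ->]; rewrite -[x]red0_polyC -red0_mul.
  exact/ext_filt_red0/ext_filt_mul.
- move=> k x _ _ /in_ext_filt[Y Yk ->] /in_ext_filt[Z Zk ->].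
  rewrite -[x]red0_polyC -!red0_mul !form_ext_coef //; try exact: ext_filt_mul.
  by rewrite (lf_comm lf) (lf_invariant lf).
- move=> k _ /in_ext_filt[X Xk ->]; rewrite -red0_bracket_euler.
  exact/ext_filt_red0/ext_filt_euler.
- move=> k _ _ _ /in_ext_filt[X Xk ->] /in_ext_filt[Y Yk ->].
  exact: form_ext_euler.
Qed.

End Proposition.

Theorem proposition5p5 (R : realType) (K : fieldType)
    (iota : {rmorphism K -> R[i]%C}) (n m : nat) (n_gt0 : (0 < n)%N)
    (D : K) (mul : 'rV[{poly mfps (n + m) K}]_(n + m) ->
                   'rV[{poly mfps (n + m) K}]_(n + m) ->
                   'rV[{poly mfps (n + m) K}]_(n + m))
    (E : 'rV[{poly mfps (n + m) K}]_(n + m)) (g : localized_metric K (n + m)) :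
  localized_frobenius D mul E g ->
  mixed_frobenius (fun k : int => D - k%:~R) (induced_mul mul) (red0 E)
    (induced_filt g) (induced_metric g).
Proof. exact: induced_mixed_frobenius. Qed.
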